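(* For every $\epsilon>0$ there is a $\delta>0$ such that the following holds. Let $\Omega$ be a finite set, let $S\colon\Omega\times\Omega\to\mathbb{R}_{\ge0}$ be a symmetric matrix with nonnegative entries, let $u,v\colon\Omega\to\mathbb{R}_{\ge 0}$ be vectors with nonnegative entries and $\|u\|_2=\|v\|_2=1$, and put $m_t=\langle v,S^t u\rangle$ for integers $t\ge 0$. Then for every integer $t\ge 2$, $$\frac{m_{t+2}}{m_t^{1+2/t}}\ \ge\ \min\left\{t^{1-\epsilon},\ \delta\,\frac{m_t^{1-2/t}}{m_{t-2}}\right\}.$$
   Context: $\langle\cdot,\cdot\rangle$ is the standard inner product on $\mathbb{R}^\Omega$. (Phrased without quotients, the conclusion says: $m_{t+2}\ge t^{1-\epsilon}m_t^{1+2/t}$ or $m_{t+2}m_{t-2}\ge \delta m_t^2$.) *)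

(* Defs.v *)
From HB Require Import structures.
From mathcomp Require Import all_boot all_order all_algebra.
From mathcomp Require Import all_classical all_reals all_analysis.
Set Implicit Arguments. Unset Strict Implicit. Unset Printing Implicit Defensive.
Import Order.TTheory GRing.Theory Num.Theory.
Local Open Scope ring_scope.

Definition moment (R : realType) (n : nat) (S : 'M[R]_n) (u v : 'cV[R]_n)
  (t : nat) : R :=
  \sum_(i < n) v i ord0 * ((S ^+ t) *m u) i ord0.

(* Main.v *)
Require Import Defs.
From HB Require Import structures.
From mathcomp Require Import all_boot all_order all_algebra.
From mathcomp Require Import all_classical all_reals all_analysis.
From mathcomp Require Import zify ring lra.
Import Order.TTheory GRing.Theory Num.Theory.
Local Open Scope ring_scope.

(** Draw a walk of length [t] with probability proportional to its weight in
[m t = <v, S^t u>], pick [r < t], and insert a detour: repeat the [r]-th step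
backwards and forwards again, conditionally independently.  By the log-sum
inequality the resulting law on walks of length [t + 2] gives
[ln m_{t+2} >= ln m_t + (tilt r - tilt (r+1)) / m_t], and averaging over [r]
telescopes to [m_{t+2} >= m_t^{1+2/t}].

The extra factor [t^{1-eps}] is the entropy of the location [r], which is
available as far as [r] can be recovered from the walk.  By Cauchy-Schwarz, if
[m_{t+2} m_{t-2} < delta m_t^2] then the laws of the vertices at times [k] and
[k + 2] of the original walk hardly overlap, so inspecting a single vertex of
the new walk tells, with small error, on which side of it the detour lies.
Binary search then finds [r], every comparison losing a small constant factor,
hence [t^eps] in all.  The search is carried out on weights: at each comparison
the weight of all walks is split by reweighting the inspected vertex with
[1 - eta] or [eta]. *)

(** * Log-sum and Cauchy-Schwarz inequalities *)

Lemma log_sum_inequality (R : realType) (I : finType) (c x y : I -> R) :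
  (forall i, 0 <= c i) -> (forall i, 0 <= x i) -> (forall i, 0 <= y i) ->
  (forall i, 0 < c i * y i -> 0 < x i) ->
  \sum_i c i * y i * (ln (x i) - ln (y i)) <=
    (\sum_i c i * y i) * (ln (\sum_i c i * x i) - ln (\sum_i c i * y i)).
Proof.
move=> c0 x0 y0 cyx; set X := \sum_i c i * x i; set Y := \sum_i c i * y i.
have cx0 i : 0 <= c i * x i by rewrite mulr_ge0.
have cy0 i : 0 <= c i * y i by rewrite mulr_ge0.
have [i0 i0P|noi] := pickP (fun i => 0 < c i * y i); last first.
  have cyE i : c i * y i = 0.
    by apply/eqP; rewrite eq_le cy0 leNgt noi.
  rewrite /Y !big1 ?mul0r // => i _; by rewrite cyE ?mul0r.
have Y0 : 0 < Y by rewrite /Y (bigD1 i0) //= ltr_pwDl // sumr_ge0.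
have c_gt0 i : 0 < c i * y i -> 0 < c i.
  by rewrite lt0r mulf_eq0 negb_or -andbA lt0r c0 => /and3P[->].
have y_gt0 i : 0 < c i * y i -> 0 < y i.
  by rewrite lt0r mulf_eq0 negb_or -andbA lt0r y0 => /and3P[_ ->].
have X0 : 0 < X.
  rewrite /X (bigD1 i0) //= ltr_pwDl // ?sumr_ge0 //.
  by rewrite mulr_gt0 ?c_gt0 ?cyx.
rewrite -subr_le0 /Y mulr_suml -/Y -sumrB.
(* Termwise this is [ln z <= z - 1] at [z = (x i / y i) * (Y / X)]; the right-hand sides add up to
   zero. *)
apply: (@le_trans _ _ (\sum_i (c i * x i * (Y / X) - c i * y i))); last first.
  by rewrite sumrB -mulr_suml -/X -/Y mulrCA divff ?mulr1 ?subrr ?gt_eqF.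
apply: ler_sum => i _.
have [cyi|] := ltP 0 (c i * y i); last first.
  move=> cyi; have -> : c i * y i = 0 by apply/eqP; rewrite eq_le cyi cy0.
  by rewrite !mul0r !subr0 mulr_ge0 // divr_ge0 // ltW.
have yi := y_gt0 _ cyi; have xi := cyx _ cyi.
have -> : c i * x i * (Y / X) - c i * y i =
          c i * y i * (x i / y i * (Y / X) - 1).
  by field; rewrite ?gt_eqF.
rewrite -mulrBr ler_pM2l //.
have -> : ln (x i) - ln (y i) - (ln X - ln Y) = ln (x i / y i * (Y / X)).
  by rewrite lnM ?posrE ?divr_gt0 // !ln_div ?posrE // opprB.
set z := _ * _; have z0 : 0 < z by rewrite mulr_gt0 ?divr_gt0.
have -> : ln z = ln (1 + (z - 1)) by congr ln; ring.
by apply: le_ln1Dx; lra.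
Qed.

Lemma cauchy_schwarz_sum (R : realType) (I : finType) (x y z : I -> R) :
  (forall i, 0 <= x i) -> (forall i, 0 <= y i) -> (forall i, 0 <= z i) ->
  (forall i, z i ^+ 2 <= x i * y i) ->
  (\sum_i z i) ^+ 2 <= (\sum_i x i) * (\sum_i y i).
Proof.
move=> x0 y0 z0 zxy; set X := \sum_i x i; set Y := \sum_i y i.
set Z := \sum_i z i.
have X0 : 0 <= X by rewrite sumr_ge0.
have Y0 : 0 <= Y by rewrite sumr_ge0.
have Z0 : 0 <= Z by rewrite sumr_ge0.
have [XE|Xn] := eqVneq X 0.
  have xE i : x i = 0 by exact: (psumr_eq0P (fun i _ => x0 i) XE).
  have zE i : z i = 0.
    have := zxy i; rewrite xE mul0r => zi.
    by apply/eqP; rewrite -sqrf_eq0 eq_le zi sqr_ge0.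
  by rewrite /Z big1 ?expr0n ?XE ?mul0r.
have Xp : 0 < X by rewrite lt0r Xn X0.
(* The minimiser of [l ^+ 2 * X - 2 * l * Z], hence the scaling at which the summed AM-GM bound
   gives Cauchy-Schwarz. *)
set l := Z / X; have l0 : 0 <= l by rewrite divr_ge0.
have H : 2 * l * Z <= l ^+ 2 * X + Y.
  rewrite mulr_sumr mulr_sumr -big_split /=; apply: ler_sum => i _.
  rewrite -(ler_pXn2r (ltn0Sn 1)) ?nnegrE ?addr_ge0 ?mulr_ge0 ?invr_ge0 //.
  have A : l ^+ 2 * z i ^+ 2 <= l ^+ 2 * (x i * y i).
    by rewrite ler_wpM2l ?sqr_ge0.
  have := sqr_ge0 (l ^+ 2 * x i - y i); nra.
have lX : l * X = Z by rewrite /l divfK.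
have := ler_wpM2r X0 H.
have -> : 2 * l * Z * X = 2 * (l * X) * Z by ring.
have -> : (l ^+ 2 * X + Y) * X = (l * X) ^+ 2 + X * Y by ring.
by rewrite lX; lra.
Qed.

(** * Relative entropy along one step of a symmetric kernel *)

Section Walks.
Variables (R : realType) (I : finType) (S : I -> I -> R).
Hypothesis S_sym : forall a b, S a b = S b a.
Hypothesis S_ge0 : forall a b, 0 <= S a b.

Definition step (h : I -> R) (a : I) : R := \sum_b S a b * h b.

Lemma step_ge0 h : (forall a, 0 <= h a) -> forall a, 0 <= step h a.
Proof. by move=> h0 a; apply: sumr_ge0 => b _; rewrite mulr_ge0. Qed.

Lemma step_adjoint f g : \sum_a f a * step g a = \sum_a step f a * g a.
Proof.
transitivity (\sum_a \sum_b f a * (S a b * g b)).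
  by apply: eq_bigr => a _; rewrite mulr_sumr.
rewrite exchange_big /=; apply: eq_bigr => b _; rewrite mulr_suml.
by apply: eq_bigr => a _; rewrite S_sym; ring.
Qed.

Lemma step_support (f g h : I -> R) :
  (forall a, 0 <= f a) -> (forall a, 0 <= g a) -> (forall a, 0 <= h a) ->
  (forall b, 0 < step f b * g b -> 0 < h b) ->
  forall a b, 0 < f a -> 0 < S a b * g b -> 0 < h b.
Proof.
move=> f0 g0 h0 fgh a b fa Sg; apply: fgh.
have [S0 gb] : 0 < S a b /\ 0 < g b.
  move: Sg; rewrite lt0r mulf_eq0 negb_or -andbA => /and3P[Sn gn _].
  by rewrite !lt0r Sn gn S_ge0 g0.
rewrite mulr_gt0 // /step (bigD1 a) //= ltr_pwDl ?sumr_ge0 //.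
  by rewrite S_sym mulr_gt0.
by move=> c _; rewrite mulr_ge0.
Qed.

Lemma step_positive (f g h : I -> R) :
  (forall a, 0 <= f a) -> (forall a, 0 <= g a) -> (forall a, 0 <= h a) ->
  (forall b, 0 < step f b * g b -> 0 < h b) ->
  forall a, 0 < f a * step g a -> 0 < step h a.
Proof.
move=> f0 g0 h0 fgh a.
rewrite lt0r mulf_eq0 negb_or -andbA => /and3P[fan sgn _].
have fa : 0 < f a by rewrite lt0r fan f0.
have [b Sgb|nob] := pickP (fun b => 0 < S a b * g b); last first.
  case/eqP: sgn; apply: big1 => b _.
  by apply/eqP; rewrite eq_le mulr_ge0 // andbT leNgt nob.
have hb := step_support _ _ _ f0 g0 h0 fgh _ _ fa Sgb.
have Sb : 0 < S a b.
  by move: Sgb; rewrite lt0r mulf_eq0 negb_or -andbA lt0r S_ge0 => /and3P[->].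
rewrite /step (bigD1 b) //= ltr_pwDl ?mulr_gt0 ?sumr_ge0 // => c _.
by rewrite mulr_ge0.
Qed.

(* The chain with joint law proportional to [f a * S a b * g b] on consecutive
   positions serves both for a forward step and, with [f] and [g] exchanged,
   for a backward step. *)
Lemma step_relative_entropy (f g h : I -> R) :
  (forall a, 0 <= f a) -> (forall a, 0 <= g a) -> (forall a, 0 <= h a) ->
  (forall b, 0 < step f b * g b -> 0 < h b) ->
  \sum_b step f b * g b * (ln (h b) - ln (g b)) <=
  \sum_a f a * step g a * (ln (step h a) - ln (step g a)).
Proof.
move=> f0 g0 h0 fgh.
have -> : \sum_b step f b * g b * (ln (h b) - ln (g b)) =
    \sum_a f a * (\sum_b S a b * g b * (ln (h b) - ln (g b))).
  have := step_adjoint f (fun b => g b * (ln (h b) - ln (g b))).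
  rewrite /step; under [in RHS]eq_bigr do rewrite mulrA.
  move=> <-; apply: eq_bigr => a _; congr (_ * _).
  by apply: eq_bigr => b _; rewrite mulrA.
apply: ler_sum => a _; rewrite -mulrA.
have [->|fa] := eqVneq (f a) 0; first by rewrite !mul0r.
apply: ler_wpM2l => //; apply: log_sum_inequality => // b.
by apply: (step_support f g h) => //; rewrite lt0r fa f0.
Qed.

Lemma sum_mulB (p x y z : I -> R) :
  \sum_a p a * (x a - z a) =
  \sum_a p a * (x a - y a) + \sum_a p a * (y a - z a).
Proof. by rewrite -big_split; apply: eq_bigr => a _ /=; ring. Qed.

Lemma sum_mul_lnM (p x y w : I -> R) :
  (forall a, 0 <= p a) -> (forall a, 0 < w a) -> (forall a, 0 < p a -> 0 < x a) ->
  \sum_a p a * (ln (w a * x a) - y a) =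
  \sum_a p a * ln (w a) + \sum_a p a * (ln (x a) - y a).
Proof.
move=> p0 w0 px; rewrite -big_split /=; apply: eq_bigr => a _.
have [pa|pa] := ltP 0 (p a).
  by rewrite lnM ?posrE ?px //; ring.
have -> : p a = 0 by apply/eqP; rewrite eq_le pa p0.
by rewrite !mul0r addr0.
Qed.

(** * Moments and reweighted walks *)

Variables (u v : I -> R).
Hypothesis u_ge0 : forall a, 0 <= u a.
Hypothesis v_ge0 : forall a, 0 <= v a.

Definition forw k := iter k step u.
Definition backw k := iter k step v.
Definition mom k := \sum_a v a * forw k a.

Lemma forw_ge0 k a : 0 <= forw k a.
Proof. by elim: k a => //= k IH a; exact: step_ge0. Qed.

Lemma backw_ge0 k a : 0 <= backw k a.
Proof. by elim: k a => //= k IH a; exact: step_ge0. Qed.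

Lemma mom_ge0 k : 0 <= mom k.
Proof. by apply: sumr_ge0 => a _; rewrite mulr_ge0 ?forw_ge0. Qed.

Lemma mom_split j k : \sum_a backw j a * forw k a = mom (j + k).
Proof.
elim: j k => [//|j IH] k.
by rewrite addSnnS -IH /= step_adjoint.
Qed.

(* Total weight of walks of length [k] ending in [u], where a vertex at
   distance [j] from the end is reweighted by [D j]. *)
Fixpoint weighted (D : nat -> I -> R) k : I -> R :=
  match k with
  | 0 => fun a => D 0%N a * u a
  | k'.+1 => fun a => D k'.+1 a * step (weighted D k') a
  end.

Definition wmom D k := \sum_a v a * weighted D k a.

Lemma weighted_ge0 D : (forall k a, 0 < D k a) -> forall k a, 0 <= weighted D k a.
Proof.
move=> D0; elim=> [|k IH] a /=; rewrite mulr_ge0 ?(ltW (D0 _ _)) //.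
exact: step_ge0.
Qed.

Lemma weighted1 k a : weighted (fun _ _ => 1) k a = forw k a.
Proof.
elim: k a => [|k IH] a /=; rewrite mul1r // /step.
by apply: eq_bigr => b _; rewrite IH.
Qed.

Lemma eq_weighted D D' k : (forall l, (l <= k)%N -> D l =1 D' l) ->
  weighted D k =1 weighted D' k.
Proof.
elim: k => [|k IH] DD' a /=; rewrite DD' // /step; congr (_ * _).
by apply: eq_bigr => b _; rewrite IH // => l lk; apply: DD'; rewrite leqW.
Qed.

Definition reweight (D : nat -> I -> R) j (c : I -> R) : nat -> I -> R :=
  fun k a => if k == j then D k a * c a else D k a.

(** [weighted] is linear in the factor at each single position, so complementary weights at position
    [j] partition the total. *)
Lemma weighted_split D j c c' k : (forall a, c a + c' a = 1) -> (j <= k)%N ->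
  forall a, weighted (reweight D j c) k a + weighted (reweight D j c') k a =
    weighted D k a.
Proof.
move=> cc'; elim: k => [|k IH].
  by rewrite leqn0 => /eqP-> a /=; rewrite /reweight eqxx -mulrDl -mulrDr cc' mulr1.
rewrite leq_eqVlt => /predU1P[->|jk] a /=.
  have RE d : reweight D k.+1 d k.+1 a = D k.+1 a * d a by rewrite /reweight eqxx.
  have E d : step (weighted (reweight D k.+1 d) k) a = step (weighted D k) a.
    apply: eq_bigr => b _; congr (_ * _); apply: eq_weighted => l lk a'.
    by rewrite /reweight ltn_eqF.
  by rewrite !RE !E -mulrDl -mulrDr cc' mulr1.
have RE d : reweight D j d k.+1 a = D k.+1 a by rewrite /reweight gtn_eqF.
rewrite !RE -mulrDr; congr (_ * _).
by rewrite /step -big_split; apply: eq_bigr => b _; rewrite /= -mulrDr IH.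
Qed.

(** * Vertex laws of the walk and of its detours *)

Variable t : nat.

Definition law k a := backw (t - k) a * forw k a.

Lemma law_ge0 k a : 0 <= law k a.
Proof. by rewrite mulr_ge0 ?forw_ge0 ?backw_ge0. Qed.

Lemma sum_law k : (k <= t)%N -> \sum_a law k a = mom t.
Proof. by move=> kt; rewrite mom_split subnK. Qed.

(** The cost of changing the reference measure at distance [k] between [forw k], natural for forward
    steps, and [backw (t - k)], natural for backward ones. *)
Definition tilt k := \sum_a law k a * (ln (backw (t - k) a) - ln (forw k a)).

(* Law of the vertex at distance [k] from the end of a random walk of length
   [t + 2], obtained from one of length [t] by repeating the step between
   distances [r] and [r + 1] backwards and forwards again. *)
Definition detour_law r k := if (k <= r.+1)%N then law k else law (k - 2)%N.

(** * Entropy bound for one detour *)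

Section Detour.
Variable D : nat -> I -> R.
Hypothesis D_gt0 : forall k a, 0 < D k a.

Lemma lawS k a : (k < t)%N -> law k a = step (backw (t - k.+1)) a * forw k a.
Proof. by move=> kt; rewrite /law -[step _]/(backw (_.+1)) subnSK. Qed.

(** Each step adds its own [ln (D l a)] term and, by [step_relative_entropy], loses nothing else.
    Positivity is carried through the induction so that no logarithm takes its default value. *)
Lemma forward_bound k : (k <= t)%N ->
  (forall a, 0 < law k a -> 0 < weighted D k a) /\
  \sum_(0 <= l < k.+1) \sum_a law l a * ln (D l a) <=
  \sum_a law k a * (ln (weighted D k a) - ln (forw k a)).
Proof.
elim: k => [|k IH] kt.
  have ux a : 0 < law 0 a -> 0 < u a.
    rewrite /law /= lt0r mulf_eq0 negb_or -andbA => /and3P[_ un _].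
    by rewrite lt0r un u_ge0.
  split=> [a /ux ua /=|]; first by rewrite mulr_gt0.
  rewrite big_nat1 /= sum_mul_lnM //; last exact: law_ge0.
  by rewrite [X in _ + X]big1 ?addr0 // => a _; rewrite subrr mulr0.
have [pos bnd] := IH (ltnW kt).
have pos' b : 0 < step (backw (t - k.+1)) b * forw k b -> 0 < weighted D k b.
  by rewrite -lawS //; exact: pos.
have wpos a : 0 < law k.+1 a -> 0 < step (weighted D k) a.
  apply: step_positive pos' a; [exact: backw_ge0|exact: forw_ge0|].
  exact: weighted_ge0.
split=> [a /wpos wa /=|]; first by rewrite mulr_gt0.
rewrite big_nat_recr //= sum_mul_lnM //; last exact: law_ge0.
rewrite addrC lerD2l (le_trans bnd) //.
under eq_bigr do rewrite lawS //.
apply: step_relative_entropy pos'; [exact: backw_ge0|exact: forw_ge0|].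
exact: weighted_ge0.
Qed.

(** The step back from [r.+1] to [r] needs reference [backw]: switching to it at [r.+1] costs
    [tilt r.+1], and returning to [forw] at [r] gains [tilt r]. *)
Lemma turn_bound r : (r < t)%N ->
  (forall a, 0 < law r a -> 0 < weighted D r.+2 a) /\
  tilt r - tilt r.+1 +
    \sum_(0 <= l < r.+3) \sum_a detour_law r l a * ln (D l a) <=
  \sum_a law r a * (ln (weighted D r.+2 a) - ln (forw r a)).
Proof.
move=> rt; have [pos bnd] := @forward_bound r.+1 rt.
have lawE a : law r a = forw r a * step (backw (t - r.+1)) a.
  by rewrite lawS // mulrC.
have pos' b : 0 < step (forw r) b * backw (t - r.+1) b -> 0 < weighted D r.+1 b.
  by rewrite mulrC; exact: pos.
have wpos a : 0 < law r a -> 0 < step (weighted D r.+1) a.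
  rewrite lawE; apply: step_positive pos' a; [exact: forw_ge0|exact: backw_ge0|].
  exact: weighted_ge0.
split=> [a /wpos wa|].
  by rewrite -[weighted D r.+2 a]/(D r.+2 a * step (weighted D r.+1) a) mulr_gt0.
rewrite -[weighted D r.+2]/(fun a => D r.+2 a * step (weighted D r.+1) a).
rewrite sum_mul_lnM //; last exact: law_ge0.
have dl : detour_law r r.+2 = law r by rewrite /detour_law ltnn !subSS subn0.
rewrite big_nat_recr //= dl addrA addrC lerD2l.
have -> : \sum_(0 <= l < r.+2) \sum_a detour_law r l a * ln (D l a) =
    \sum_(0 <= l < r.+2) \sum_a law l a * ln (D l a).
  by apply: eq_big_nat => l /andP[_ lr]; rewrite /detour_law -ltnS lr.
have ent := step_relative_entropy (forw r) (backw (t - r.+1)) (weighted D r.+1)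
  (forw_ge0 r) (backw_ge0 _) (weighted_ge0 D D_gt0 _) pos'.
rewrite (sum_mulB _ _ (fun a => ln (backw (t - r) a))) -/(tilt r).
rewrite (sum_mulB _ _ (fun a => ln (backw (t - r.+1) a))) -/(tilt r.+1) in bnd.
have e1 : \sum_a law r a * (ln (step (weighted D r.+1) a) - ln (backw (t - r) a)) =
    \sum_a forw r a * step (backw (t - r.+1)) a *
      (ln (step (weighted D r.+1) a) - ln (step (backw (t - r.+1)) a)).
  apply: eq_bigr => a _.
  by rewrite lawE -[step (backw _)]/(backw (_.+1)) subnSK.
have e2 : \sum_a law r.+1 a * (ln (weighted D r.+1 a) - ln (backw (t - r.+1) a)) =
    \sum_a step (forw r) a * backw (t - r.+1) a *
      (ln (weighted D r.+1 a) - ln (backw (t - r.+1) a)).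
  by apply: eq_bigr => a _; rewrite /law [backw _ a * _]mulrC.
by rewrite e1; rewrite e2 in bnd; lra.
Qed.

(** After the turn the walk moves forwards again, two steps late: distance [k.+2] carries
    [law k]. *)
Lemma after_turn_bound r k : (r < t)%N -> (r <= k)%N -> (k <= t)%N ->
  (forall a, 0 < law k a -> 0 < weighted D k.+2 a) /\
  tilt r - tilt r.+1 +
    \sum_(0 <= l < k.+3) \sum_a detour_law r l a * ln (D l a) <=
  \sum_a law k a * (ln (weighted D k.+2 a) - ln (forw k a)).
Proof.
move=> rt; elim: k => [|k IH].
  by rewrite leqn0 => /eqP r0 _; have := turn_bound r rt; rewrite r0.
rewrite leq_eqVlt => /predU1P[rk|rk] kt.
  by have := turn_bound r rt; rewrite rk.
have [pos bnd] := IH rk (ltnW kt).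
have pos' b : 0 < step (backw (t - k.+1)) b * forw k b -> 0 < weighted D k.+2 b.
  by rewrite -lawS //; exact: pos.
have wpos a : 0 < law k.+1 a -> 0 < step (weighted D k.+2) a.
  apply: step_positive pos' a; [exact: backw_ge0|exact: forw_ge0|].
  exact: weighted_ge0.
split=> [a /wpos wa|].
  by rewrite -[weighted D k.+3 a]/(D k.+3 a * step (weighted D k.+2) a) mulr_gt0.
rewrite -[weighted D k.+3]/(fun a => D k.+3 a * step (weighted D k.+2) a).
rewrite sum_mul_lnM //; last exact: law_ge0.
have dl : detour_law r k.+3 = law k.+1.
  by rewrite /detour_law ifF ?subSS ?subn0 //; lia.
rewrite big_nat_recr // addrA addrC dl lerD2l (le_trans bnd) //.
rewrite (eq_bigr (fun a => step (backw (t - k.+1)) a * forw k a *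
    (ln (weighted D k.+2 a) - ln (forw k a)))); last by move=> a _; rewrite lawS.
apply: step_relative_entropy pos'; [exact: backw_ge0|exact: forw_ge0|].
exact: weighted_ge0.
Qed.

(** A last log-sum, weighted by [v], closes the walk at its other end. *)
Lemma detour_bound r : (r < t)%N ->
  mom t * ln (mom t) + (tilt r - tilt r.+1) +
    \sum_(0 <= l < t.+3) \sum_a detour_law r l a * ln (D l a) <=
  mom t * ln (wmom D t.+2) /\ (0 < mom t -> 0 < wmom D t.+2).
Proof.
move=> rt; have [pos bnd] := after_turn_bound r t rt (ltnW rt) (leqnn t).
have lawt a : law t a = v a * forw t a by rewrite /law subnn.
have pos' a : 0 < v a * forw t a -> 0 < weighted D t.+2 a.
  by rewrite -lawt; exact: pos.
have := log_sum_inequality _ _ v (weighted D t.+2) (forw t) v_ge0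
  (weighted_ge0 D D_gt0 _) (forw_ge0 t) pos'.
under eq_bigr do rewrite -lawt.
rewrite -/(mom t) -/(wmom D t.+2).
move=> ls; split; first by move: bnd ls; rewrite mulrBr; lra.
move=> M0; have [a la|nola] := pickP (fun a => 0 < law t a); last first.
  suff: mom t = 0 by move=> M1; rewrite M1 ltxx in M0.
  apply: big1 => a _; apply/eqP; rewrite -lawt eq_le law_ge0 andbT leNgt.
  by rewrite nola.
rewrite /wmom (bigD1 a) // ltr_pwDl ?sumr_ge0 // => [|b _].
  rewrite mulr_gt0 //; last exact: pos.
  rewrite lt0r v_ge0 andbT; apply: contraTneq la => va.
  by rewrite lawt va mul0r ltxx.
by rewrite mulr_ge0 ?(weighted_ge0 D D_gt0 t.+2).
Qed.

End Detour.

(** Swapping the backward factors of [law k] and [law k.+2] regroups their product into terms of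
    walks of lengths [t - 2] and [t + 2]; moreover [min(p, q)^2 <= p * q]. *)
Lemma overlap_bound k : (k.+2 <= t)%N ->
  (\sum_a Num.min (law k a) (law k.+2 a)) ^+ 2 <= mom (t - 2) * mom t.+2.
Proof.
move=> kt.
have -> : (t - 2 = (t - k.+2) + k)%N by lia.
have -> : (t.+2 = (t - k) + k.+2)%N by lia.
rewrite -!mom_split; apply: cauchy_schwarz_sum => a.
- by rewrite mulr_ge0 ?backw_ge0 ?forw_ge0.
- by rewrite mulr_ge0 ?backw_ge0 ?forw_ge0.
- by rewrite le_min !law_ge0.
- have -> : backw (t - k.+2) a * forw k a * (backw (t - k) a * forw k.+2 a) =
      law k a * law k.+2 a by rewrite /law; ring.
  rewrite expr2; apply: ler_pM; rewrite ?le_min ?law_ge0 //.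
    by rewrite ge_min lexx.
  by rewrite ge_min lexx orbT.
Qed.

Lemma sum_detour_reweight D j (w : I -> R) r :
  (forall k a, 0 < D k a) -> (forall a, 0 < w a) -> (j < t.+3)%N ->
  \sum_(0 <= l < t.+3) \sum_a detour_law r l a * ln (reweight D j w l a) =
  \sum_(0 <= l < t.+3) \sum_a detour_law r l a * ln (D l a) +
    \sum_a detour_law r j a * ln (w a).
Proof.
move=> D0 w0 jt.
have -> : \sum_a detour_law r j a * ln (w a) =
    \sum_(0 <= l < t.+3 | l == j) \sum_a detour_law r l a * ln (w a).
  by rewrite big_nat1_eq leq0n jt.
rewrite [X in _ = _ + X]big_mkcond -big_split /=; apply: eq_bigr => l _.
rewrite /reweight; case: eqP => _; last by rewrite addr0.
rewrite -big_split /=; apply: eq_bigr => a _.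
by rewrite lnM ?posrE // mulrDr.
Qed.

(** * Binary search for the detour *)

Section Search.
Variables (eta s : R).
Hypothesis eta_gt0 : 0 < eta.
Hypothesis eta_lt1 : eta < 1.
Hypothesis mom_gt0 : 0 < mom t.
Hypothesis overlap : forall k, (k.+2 <= t)%N ->
  \sum_a Num.min (law k a) (law k.+2 a) <= s * mom t.
Hypothesis s_ge0 : 0 <= s.

(** Logarithmic loss of one comparison per unit mass: a right guess is weighted by [1 - eta], and
    wrong guesses, of mass at most [s], by [eta]. *)
Definition test_cost := - (ln (1 - eta) + s * ln eta).

Lemma ln_eta_le0 : ln eta <= 0.
Proof. by apply: ln_le0; exact: ltW. Qed.

Lemma ln_1Beta_le0 : ln (1 - eta) <= 0.
Proof. by apply: ln_le0; rewrite gerBl ltW. Qed.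

Lemma test_cost_ge0 : 0 <= test_cost.
Proof.
rewrite /test_cost oppr_ge0 -[leRHS]addr0 lerD ?ln_1Beta_le0 //.
by rewrite mulr_ge0_le0 // ln_eta_le0.
Qed.

(** Under the true law [p] the guess is wrong only where [p <= q], and there [p] is the minimum, so
    the overlap bounds the error. *)
Lemma test_bound (p q : I -> R) (b : pred I) :
  (forall a, 0 <= p a) -> (forall a, 0 <= q a) ->
  (forall a, ~~ b a -> p a <= q a) ->
  \sum_a p a = mom t -> \sum_a Num.min (p a) (q a) <= s * mom t ->
  - test_cost * mom t <= \sum_a p a * ln (if b a then 1 - eta else eta).
Proof.
move=> p0 q0 bpq pE ov.
have le1 := ln_1Beta_le0; have le2 := ln_eta_le0.
apply: (@le_trans _ _ (\sum_a (p a * ln (1 - eta) + Num.min (p a) (q a) * ln eta))).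
  rewrite big_split /= -!mulr_suml pE /test_cost.
  by have := ler_wnM2r le2 ov; lra.
apply: ler_sum => a _; have m0 : 0 <= Num.min (p a) (q a) by rewrite le_min p0 q0.
case: ifPn => [_|/bpq pq].
  by have := mulr_ge0_le0 m0 le2; lra.
by rewrite (min_idPl pq); have := mulr_ge0_le0 (p0 a) le1; lra.
Qed.

(** The lower bound on [ln (wmom D t.+2)] furnished by the detour at [r] alone. *)
Definition exponent D r := ln (mom t) + (tilt r - tilt r.+1 +
  \sum_(0 <= l < t.+3) \sum_a detour_law r l a * ln (D l a)) / mom t.

(* Binary search for the location [r] of the detour: the vertex at distance
   [mid + 1] tells [r < mid] from [r >= mid], as [law (mid - 1)] and
   [law (mid + 1)] hardly overlap. *)
Lemma search_bound d lo D : (forall k a, 0 < D k a) ->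
  \sum_(lo <= r < minn (lo + 2 ^ d) t) expR (exponent D r - test_cost * d%:R) <=
  wmom D t.+2.
Proof.
elim: d lo D => [|d IH] lo D D0.
  have wm0 : 0 <= wmom D t.+2.
    by apply: sumr_ge0 => a _; rewrite mulr_ge0 ?weighted_ge0.
  rewrite expn0 addn1; have [lt|lt] := leqP t lo.
    by rewrite big_geq //; lia.
  rewrite (minn_idPl lt) big_nat1 mulr0 subr0.
  have [bnd wm] := detour_bound D D0 lo lt.
  rewrite -[X in _ <= X]lnK ?posrE ?wm // ler_expR /exponent.
  rewrite -(ler_pM2l mom_gt0) mulrDr mulrCA divff ?mulr1 ?gt_eqF //.
  by rewrite addrA.
set mid := (lo + 2 ^ d)%N.
have c0 := test_cost_ge0.
have mid0 : (0 < mid)%N by rewrite addn_gt0 expn_gt0 orbT.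
have hiE : (lo + 2 ^ d.+1 = mid + 2 ^ d)%N by rewrite expnS /mid; lia.
(* If [t <= mid], the right half holds no location; no test is made and one test cost is given
   away. *)
rewrite hiE; have [tmid|midt] := leqP t mid.
  have -> : minn (mid + 2 ^ d) t = minn (lo + 2 ^ d) t by rewrite -/mid; lia.
  apply: le_trans (IH lo D D0); apply: ler_sum => r _; rewrite ler_expR lerB //.
  by rewrite ler_wpM2l // ler_nat.
(* Likelihood comparison of the two candidate laws: [b a] guesses [r < mid]. The weights [wl] and
   [wr] of the two guesses add up to 1. *)
pose b a := law mid.+1 a <= law mid.-1 a.
pose wl a := if b a then 1 - eta else eta.
pose wr a := if ~~ b a then 1 - eta else eta.
have w0 (e : bool) : 0 < (if e then 1 - eta else eta).
  by case: e => //; rewrite subr_gt0.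
have wlr a : wl a + wr a = 1.
  by rewrite /wl /wr; case: (b a); rewrite /= ?subrK // addrC subrK.
have rw0 w : (forall a, 0 < w a) -> forall k a, 0 < reweight D mid.+1 w k a.
  by move=> wp k a; rewrite /reweight; case: ifP => // _; rewrite mulr_gt0.
have -> : wmom D t.+2 = wmom (reweight D mid.+1 wl) t.+2 +
                        wmom (reweight D mid.+1 wr) t.+2.
  rewrite /wmom -big_split /=; apply: eq_bigr => a _; rewrite -mulrDr.
  by rewrite (weighted_split D mid.+1 wl wr t.+2 wlr) //; lia.
have midE : mid.-1.+2 = mid.+1 by rewrite prednK.
have ov := overlap mid.-1; rewrite midE in ov; have {}ov := ov midt.
have lo_mid : (lo <= mid)%N by rewrite leq_addr.
rewrite (@big_cat_nat _ _ _ mid) //=; last by rewrite leq_min leq_addr ltnW.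
have key w r : (forall a, 0 < w a) ->
    - test_cost * mom t <= \sum_a detour_law r mid.+1 a * ln (w a) ->
    exponent D r - test_cost * d.+1%:R <=
    exponent (reweight D mid.+1 w) r - test_cost * d%:R.
  move=> wp tb; rewrite /exponent sum_detour_reweight //; last by lia.
  rewrite [X in _ <= _ + X / _ - _]addrA [X in _ <= _ + X - _]mulrDl.
  rewrite -(ler_pdivlMr _ _ mom_gt0) in tb.
  rewrite -natr1 mulrDr mulr1; move: tb; lra.
apply: lerD.
- apply: le_trans (IH lo _ (rw0 wl (fun a => w0 _))).
  rewrite -/mid (minn_idPl (ltnW midt)); apply: ler_sum_nat => r /andP[_ rm].
  rewrite ler_expR; apply: key => [a|]; first exact: w0.
  have -> : detour_law r mid.+1 = law mid.-1.
    by rewrite /detour_law ifF ?subSS ?subn1 //; lia.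
  apply: (test_bound _ (law mid.+1)) => //; try exact: law_ge0.
  + by move=> a; rewrite -ltNge => /ltW.
  + by apply: sum_law; lia.
- apply: le_trans (IH mid _ (rw0 wr (fun a => w0 _))).
  apply: ler_sum_nat => r /andP[rm _].
  rewrite ler_expR; apply: key => [a|]; first exact: w0.
  have -> : detour_law r mid.+1 = law mid.+1.
    by rewrite /detour_law ltnS rm.
  apply: (test_bound _ (law mid.-1)) => //; try exact: law_ge0.
  + by move=> a; rewrite negbK.
  + exact: sum_law.
  + by under eq_bigr do rewrite minC.
Qed.

(** The unit norms of [u] and [v] bound [tilt 0] and [tilt t], so the telescoped tilts give the
    power [2 / t]; summing over [t] locations gives the factor [t]. *)
Lemma mom_growth d : (0 < t)%N -> (t <= 2 ^ d)%N ->
  \sum_a u a ^+ 2 = 1 -> \sum_a v a ^+ 2 = 1 ->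
  expR (ln t%:R + (1 + 2 / t%:R) * ln (mom t) - test_cost * d%:R) <= mom t.+2.
Proof.
move=> t0 td u1 v1.
have tilt0 : mom t * ln (mom t) <= tilt 0.
  have := log_sum_inequality R I u u (backw t) u_ge0 u_ge0 (backw_ge0 t).
  have -> : \sum_a u a * u a = 1 by rewrite -u1; apply: eq_bigr => a _; rewrite expr2.
  have -> : \sum_a u a * backw t a = mom t.
    by rewrite -(sum_law 0) // /law subn0; apply: eq_bigr => a _; rewrite mulrC.
  have -> : \sum_a u a * backw t a * (ln (u a) - ln (backw t a)) = - tilt 0.
    by rewrite /tilt /law subn0 -sumrN; apply: eq_bigr => a _ /=; ring.
  rewrite ln1 sub0r mulrN lerN2; apply=> a ub.
  by rewrite lt0r u_ge0 andbT; apply: contraTneq ub => ->; rewrite mul0r ltxx.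
have tiltt : tilt t <= - (mom t * ln (mom t)).
  have := log_sum_inequality R I v v (forw t) v_ge0 v_ge0 (forw_ge0 t).
  have -> : \sum_a v a * v a = 1 by rewrite -v1; apply: eq_bigr => a _; rewrite expr2.
  rewrite -/(mom t) ln1 sub0r mulrN /tilt /law subnn; apply=> a vb.
  by rewrite lt0r v_ge0 andbT; apply: contraTneq vb => ->; rewrite mul0r ltxx.
have tR : 0 < t%:R :> R by rewrite ltr0n.
pose x (r : nat) := ln (mom t) + (tilt r - tilt r.+1) / mom t - test_cost * d%:R.
have sumE : \sum_(r < t) expR (x r) <= mom t.+2.
  have := search_bound d 0 (fun _ _ => 1) (fun _ _ => ltr01).
  rewrite add0n (minn_idPr td) big_mkord.
  have -> : wmom (fun _ _ => 1) t.+2 = mom t.+2.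
    by apply: eq_bigr => a _; rewrite weighted1.
  apply: le_trans; apply: ler_sum => r _; rewrite /x /exponent big1 ?addr0 //.
  by move=> l _; rewrite big1 // => a _; rewrite ln1 mulr0.
have sumx : \sum_(r < t) x r =
    t%:R * (ln (mom t) - test_cost * d%:R) + (tilt 0 - tilt t) / mom t.
  rewrite -(big_mkord xpredT x) /x.
  have -> : tilt 0 - tilt t = \sum_(0 <= r < t) (tilt r - tilt r.+1).
    rewrite -opprB -telescope_sumr // -sumrN.
    by apply: eq_bigr => r _; rewrite opprB.
  under eq_bigr do rewrite addrAC.
  by rewrite mulr_suml big_split /= sumr_const_nat subn0 mulr_natl.
have tilts : 2 * ln (mom t) <= (tilt 0 - tilt t) / mom t.
  by rewrite ler_pdivlMr //; move: tilt0 tiltt; lra.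
(* Log-sum against the constant 1 acts as Jensen's inequality: the sum of the [expR (x r)] is at
   least [t] times [expR] of their mean exponent. *)
have amgm := log_sum_inequality R 'I_t (fun _ => 1) (fun r => expR (x r))
  (fun _ => 1) (fun _ => ler01) (fun r => expR_ge0 _) (fun _ => ler01)
  (fun r _ => expR_gt0 _).
move: amgm; under eq_bigr do rewrite !mul1r expRK ln1 subr0.
under [X in _ <= _ * (ln X - _)]eq_bigr do rewrite mul1r.
rewrite !mul1r sumr_const card_ord sumx => amgm.
have sum0 : 0 < \sum_(r < t) expR (x r).
  by rewrite (bigD1 (Ordinal t0)) //= ltr_pwDl ?expR_gt0 ?sumr_ge0.
have mom0 : 0 < mom t.+2 by exact: lt_le_trans sumE.
have lnle : ln (\sum_(r < t) expR (x r)) <= ln (mom t.+2).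
  by rewrite ler_ln // posrE.
rewrite -[leRHS]lnK // ler_expR -(ler_pM2l tR).
have -> : t%:R * (ln t%:R + (1 + 2 / t%:R) * ln (mom t) - test_cost * d%:R) =
   t%:R * (ln (mom t) - test_cost * d%:R) + 2 * ln (mom t) + t%:R * ln t%:R.
  by field; rewrite gt_eqF.
have := ler_wpM2l (ltW tR) lnle; move: amgm tilts; lra.
Qed.

End Search.

End Walks.

(** * Return to matrices and choice of constants *)

Lemma momentE (R : realType) (n : nat) (S : 'M[R]_n) (u v : 'cV[R]_n) k :
  moment S u v k = mom R _ S (u ^~ ord0) (v ^~ ord0) k.
Proof.
apply: eq_bigr => i _; congr (_ * _).
elim: k i => [|k IH] i /=; first by rewrite expr0 mul1mx.
rewrite exprS -mulmxE -mulmxA mxE /step.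
by apply: eq_bigr => j _; rewrite IH.
Qed.

Theorem theorem1p4 (R : realType) (eps : R) (heps : 0 < eps) :
  exists delta : R, 0 < delta /\
  forall (n : nat) (S : 'M[R]_n) (u v : 'cV[R]_n),
    S^T = S ->
    (forall i j, 0 <= S i j) ->
    (forall i, 0 <= u i ord0) -> (forall i, 0 <= v i ord0) ->
    \sum_(i < n) u i ord0 ^+ 2 = 1 -> \sum_(i < n) v i ord0 ^+ 2 = 1 ->
    forall t : nat, (2 <= t)%N ->
      let m := moment S u v in
      m t.+2 >= (t%:R `^ (1 - eps)) * (m t `^ (1 + 2 / t%:R))
      \/ m t.+2 * m (t - 2)%N >= delta * m t ^+ 2.
Proof.
have ln2 : 0 < ln (2 : R) by apply: ln_gt0; rewrite ltr1n.
(* [eta] and [s] are chosen so that [ln (1 - eta)] and [s * ln eta] both equal [- c]; each test then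
   costs [2 * c]. *)
pose c : R := eps * ln 2 / 4.
have c0 : 0 < c by rewrite divr_gt0 ?mulr_gt0.
pose eta : R := 1 - expR (- c).
have eta0 : 0 < eta by rewrite subr_gt0 expR_lt1 oppr_lt0.
have eta1 : eta < 1 by rewrite gtrBl expR_gt0.
have lneta : ln eta < 0 by apply: ln_lt0; rewrite eta0.
pose s := c / - ln eta.
have s0 : 0 < s by rewrite divr_gt0 // oppr_gt0.
have costE : test_cost R eta s = eps * ln 2 / 2.
  rewrite /test_cost /eta opprB addrCA subrr addr0 expRK -/eta /s invrN.
  by rewrite mulrN mulNr divfK ?lt_eqF // /c; lra.
(* The square comes from [overlap_bound], which controls the squared overlap. *)
exists (s ^+ 2); split; first by rewrite exprn_gt0.
move=> n S u v Ssym S0 u0 v0 u1 v1 t t2 m.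
have [|alt2] := lerP (s ^+ 2 * m t ^+ 2) (m t.+2 * m (t - 2)%N); [by right|left].
have symS a b : S a b = S b a by rewrite -{1}Ssym mxE.
have mE k : m k = mom R _ S (u ^~ ord0) (v ^~ ord0) k by exact: momentE.
have m0 k : 0 <= m k by rewrite mE; exact: mom_ge0.
have tR : 0 < t%:R :> R by rewrite ltr0n ltnW.
have [mt|mt] := eqVneq (m t) 0.
  rewrite mt powR0 ?mulr0 // gt_eqF // addr_gt0 // divr_gt0 //.
have mt0 : 0 < m t by rewrite lt0r mt m0.
have ov k : (k.+2 <= t)%N -> \sum_a Num.min
    (law R _ S (u ^~ ord0) (v ^~ ord0) t k a)
    (law R _ S (u ^~ ord0) (v ^~ ord0) t k.+2 a) <= s * m t.
  move=> kt; rewrite -(ler_pXn2r (ltn0Sn 1)) ?nnegrE; last first.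
  - by rewrite mulr_ge0 // ltW.
  - by apply: sumr_ge0 => a _; rewrite le_min !law_ge0.
  apply: le_trans (overlap_bound R _ S symS S0 _ _ u0 v0 t k kt) _.
  by rewrite -!mE exprMn mulrC ltW.
have := mom_growth R _ S symS S0 _ _ u0 v0 t eta s eta0 eta1 _ _ (ltW s0)
  (up_log 2 t) (ltnW t2) (up_logP _ _) u1 v1.
rewrite -!mE costE => /(_ mt0 ov isT) bnd.
apply: le_trans bnd; rewrite /powR !gt_eqF // -expRD ler_expR.
suff : eps * ln 2 / 2 * (up_log 2 t)%:R <= eps * ln t%:R by lra.
(* Minimality of [up_log] gives [2 ^ up_log 2 t < 2 * t <= t ^ 2], so the depth is at most
   [2 * ln t / ln 2] and all tests together cost at most [eps * ln t]. *)
have : ln (2 ^+ up_log 2 t) <= ln (t%:R ^+ 2 : R).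
  rewrite ler_ln ?posrE ?exprn_gt0 // -!natrX ler_nat.
  have := up_log_gtn (isT : (1 < 2)%N) t2.
  have : (0 < up_log 2 t)%N by rewrite up_log_gt0.
  case: (up_log 2 t) => // k _ /=; rewrite expnS; nia.
rewrite !lnXn // -[X in X <= _ -> _]mulr_natl -[X in _ <= X -> _]mulr_natl => lnle.
by have := ler_wpM2l (ltW heps) lnle; lra.
Qed.
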